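(* Let $\{X_k\}$ be a finite adapted sequence of random matrices with values in $\mathcal{S}_d$ and let $\{A_k\}$ be a fixed (deterministic) sequence of matrices in $\mathcal{S}_d$, satisfying for every $k$ $$\mathbb{E}(X_k \mid X_1, \ldots , X_{k-1}) = 0 \quad \text{and} \quad X_k^2 \preceq A_k^2 \quad \text{almost surely.}$$ Put $\sigma^2:=\left\|\sum_k A_k^2 \right\|$. Then, for all $t\geq 0$, $$\mathbb{P}\left\{\lambda_{\min} \left(\sum_k X_k \right) \geq t \right\} \leq e^{-t^2/(8\sigma^2)},$$ and hence $$\mathbb{P}\left\{\lambda_{\max} \left(\sum_k X_k \right) \leq -t \right\} \leq e^{-t^2/(8\sigma^2)}.$$
   Context: $\mathcal{S}_d$ denotes the set of $d\times d$ real symmetric matrices. The Loewner order: for $A,B\in\mathcal{S}_d$, $A \preceq B$ means $B-A$ is positive semidefinite. $\|\cdot\|$ is the operator norm (largest singular value); $\lambda_{\min},\lambda_{\max}$ denote the smallest and largest eigenvalues. *)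

(* Defs.v *)
From HB Require Import structures.
From mathcomp Require Import all_boot all_order all_algebra.
From mathcomp Require Import all_classical all_reals all_analysis.

Set Implicit Arguments.
Unset Strict Implicit.
Unset Printing Implicit Defensive.

Import Order.TTheory GRing.Theory Num.Theory.

Local Open Scope classical_set_scope.
Local Open Scope ring_scope.

Section Matrices.
Context {R : realType} {d : nat}.
Implicit Types A B : 'M[R]_d.

Definition psdmx A : Prop :=
  A \is symmetricmx /\ forall v : 'rV[R]_d, 0 <= (v *m A *m v^T) 0 0.

Definition loewner_le A B : Prop := psdmx (B - A).

(* The spectrum is finite, and for A symmetric with 0 < d it is nonempty;
   the infimum and the supremum are then its least and greatest elements. *)
Definition lambda_min A : R := inf [set a | eigenvalue A a].
Definition lambda_max A : R := sup [set a | eigenvalue A a].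

Definition singular_value A (s : R) : Prop :=
  0 <= s /\ eigenvalue (A^T *m A) (s ^+ 2).

Definition opnorm A : R := sup [set s | singular_value A s].

End Matrices.

Section RandomMatrices.
Context {disp : measure_display} {T : measurableType disp} {R : realType}.
Implicit Types (G : set (set T)).

Definition sub_sigma_algebra G : Prop :=
  sigma_algebra setT G /\ G `<=` measurable.

Definition filtration (n : nat) (F : 'I_n -> set (set T)) : Prop :=
  (forall k, sub_sigma_algebra (F k)) /\
  (forall j k : 'I_n, (j <= k)%N -> F j `<=` F k).

(* preimages of the Borel sets of R by the entries of Y *)
Definition mx_preimages (d : nat) (Y : T -> 'M[R]_d) : set (set T) :=
  [set B | exists i j : 'I_d,
     preimage_set_system setT (fun w => Y w i j) measurable B].

Definition adapted (n d : nat) (F : 'I_n -> set (set T))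
    (X : 'I_n -> T -> 'M[R]_d) : Prop :=
  forall k, mx_preimages (X k) `<=` F k.

(* sigma(X_j, j < k); the trivial sigma-algebra when k = 0 *)
Definition past (n d : nat) (X : 'I_n -> T -> 'M[R]_d) (k : 'I_n) :
    set (set T) :=
  <<s \bigcup_(j in [set j : 'I_n | (j < k)%N]) mx_preimages (X j) >>.

(* Z is a version of the conditional expectation of Y given G *)
Definition is_cond_expectation (P : probability T R) G (Y Z : T -> R) : Prop :=
  [/\ P.-integrable setT (EFin \o Y),
      P.-integrable setT (EFin \o Z),
      preimage_set_system setT Z measurable `<=` G &
      forall B, G B -> (\int[P]_(w in B) (Y w)%:E = \int[P]_(w in B) (Z w)%:E)%E].

Definition is_mx_cond_expectation (d : nat) (P : probability T R) G
    (Y Z : T -> 'M[R]_d) : Prop :=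
  forall i j, is_cond_expectation P G (fun w => Y w i j) (fun w => Z w i j).

End RandomMatrices.

(* Main.v *)
(* The smallest eigenvalue of S = \sum_k X_k is at most its mean eigenvalue
   tr S / d, so a scalar martingale argument suffices and no dimensional factor
   appears. The numbers Y_k = tr X_k / d form a martingale difference sequence,
   and by Cauchy-Schwarz Y_k^2 <= tr (X_k^2) / d <= tr (A_k^2) / d =: a_k^2,
   with \sum_k a_k^2 <= sigma^2. From e^x <= x + e^(2 x^2) one gets
   E e^(l Y_0 + ... + l Y_(n-1)) <= e^(2 l^2 \sum_k a_k^2) by conditioning, and
   Markov's inequality with l = t / (4 sigma^2) gives the constant 8.
   The bound for lambda_max is the one for lambda_min applied to - X_k. *)
Require Import Defs.
From HB Require Import structures.
From mathcomp Require Import all_boot all_order all_algebra.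
From mathcomp Require Import all_classical all_reals all_analysis.
From mathcomp Require Import ring lra measurable_realfun.
Set Implicit Arguments.
Unset Strict Implicit.
Unset Printing Implicit Defensive.
Import Order.TTheory GRing.Theory Num.Theory.
Import numFieldNormedType.Exports.
Local Open Scope classical_set_scope.
Local Open Scope ring_scope.

(** * Extreme eigenvalues of symmetric matrices *)

Section SymmetricMatrices.
Context {R : realType}.

Lemma symmetricmx_tr d (A : 'M[R]_d) : A \is symmetricmx -> A^T = A.
Proof. by rewrite is_hermitianmxE expr0 scale1r map_mx_id // => /eqP {2}->. Qed.

Lemma symmetricmxE d (A : 'M[R]_d) : A^T = A -> A \is symmetricmx.
Proof. by move=> At; rewrite is_hermitianmxE expr0 scale1r map_mx_id // At. Qed.

Lemma qformE d (A : 'M[R]_d) (v : 'rV_d) :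
  (v *m A *m v^T) 0 0 = \sum_i \sum_j v 0 j * A j i * v 0 i.
Proof.
by rewrite !mxE; apply: eq_bigr => i _; rewrite !mxE mulr_suml.
Qed.

Lemma qform_delta d (A : 'M[R]_d) (i : 'I_d) :
  ((delta_mx 0 i : 'rV_d) *m A *m (delta_mx 0 i : 'rV_d)^T) 0 0 = A i i :> R.
Proof. by rewrite -rowE trmx_delta -(colE i) !mxE. Qed.

Lemma dotmxE d (v : 'rV[R]_d) : (v *m v^T) 0 0 = \sum_i v 0 i ^+ 2.
Proof. by rewrite mxE; apply: eq_bigr => i _; rewrite mxE expr2. Qed.

Lemma dotmx_gt0 d (v : 'rV[R]_d) : v != 0 -> 0 < (v *m v^T) 0 0.
Proof.
move=> v0; rewrite lt_neqAle dotmxE sumr_ge0 ?andbT; last by move=> i _; exact: sqr_ge0.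
apply: contra v0 => /eqP/esym/eqP; rewrite psumr_eq0; last by move=> i _; exact: sqr_ge0.
move=> /allP v0; apply/eqP/rowP => i; rewrite mxE; apply/eqP.
by rewrite -sqrf_eq0; apply: v0; rewrite mem_index_enum.
Qed.

(** * Quadratic forms on the unit sphere and their minimisers *)

Lemma continuous_coord_sum d (I : Type) (r : seq I) (f : I -> 'rV[R]_d -> R) :
  (forall i, continuous (f i)) -> continuous (fun v => \sum_(i <- r) f i v).
Proof. by move=> cf; apply: continuous_big => //; exact: add_continuous. Qed.

Lemma continuous_qform d (A : 'M[R]_d) :
  continuous (fun v : 'rV[R]_d => (v *m A *m v^T) 0 0).
Proof.
rewrite (_ : (fun v => _) =
    fun v : 'rV[R]_d => \sum_i \sum_j v 0 j * A j i * v 0 i); last first.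
  by apply/funext => v; exact: qformE.
apply: continuous_coord_sum => i; apply: continuous_coord_sum => j; move=> v.
apply: (@continuousM _ _ (fun v : 'rV[R]_d => v 0 j * A j i)); last exact: coord_continuous.
apply: (@continuousM _ _ (fun v : 'rV[R]_d => v 0 j)); first exact: coord_continuous.
exact: cst_continuous.
Qed.

Lemma compact_sphere d : compact [set v : 'rV[R]_d | (v *m v^T) 0 0 = 1].
Proof.
apply: bounded_closed_compact.
  exists 1; split; first exact: num_real.
  move=> M M1 v /= v1; rewrite [leLHS]mx_normrE.
  apply/bigmax_leP; split => [|[i j] _ /=]; first by rewrite ltW ?(lt_trans ltr01).
  apply: le_trans (ltW M1); rewrite ord1 -(@ler_pXn2r _ 2) ?nnegrE//.
  rewrite real_normK ?num_real// expr1n -v1 dotmxE (bigD1 j)//=.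
  by rewrite lerDl sumr_ge0// => k _; exact: sqr_ge0.
have -> : [set v : 'rV[R]_d | (v *m v^T) 0 0 = 1] =
    (fun v : 'rV[R]_d => (v *m 1%:M *m v^T) 0 0) @^-1` [set 1].
  by apply/seteqP; split => v /=; rewrite mulmx1.
apply: closed_comp => [v _|]; first exact: continuous_qform.
exact: closed_eq.
Qed.

(* A minimiser v of the Rayleigh quotient is an eigenvector: otherwise moving v
   in the direction v *m (A - a%:M) would decrease the quadratic form. *)
Lemma rayleigh_min d (A : 'M[R]_d) : (0 < d)%N -> A \is symmetricmx ->
  exists2 a, eigenvalue A a &
    forall v : 'rV_d, a * (v *m v^T) 0 0 <= (v *m A *m v^T) 0 0.
Proof.
move=> d0 /symmetricmx_tr Asym.
have [] := @EVT_min_rV R d (fun v => (v *m A *m v^T) 0 0) _ _ (@compact_sphere d).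
- exists (delta_mx 0 (Ordinal d0)) => /=.
  by rewrite -[X in X *m _]mulmx1 qform_delta mxE eqxx.
- by apply: continuous_subspaceT; exact: continuous_qform.
move=> u; rewrite inE/= => u1 umin; set a := (u *m A *m u^T) 0 0 in umin.
(* Both sides are homogeneous of degree 2, so the minimality of [u] on the unit sphere extends to
   every [v] after rescaling by [k]. *)
have amin (v : 'rV_d) : a * (v *m v^T) 0 0 <= (v *m A *m v^T) 0 0.
  have [->|v0] := eqVneq v 0; first by rewrite !mul0mx mxE mulr0.
  have n0 := dotmx_gt0 v0; pose s : R := (v *m v^T) 0 0.
  pose k := (Num.sqrt s)^-1.
  have k0 : 0 < Num.sqrt s by rewrite sqrtr_gt0.
  have ks : k * (k * s) = 1.
    by rewrite -[X in _ * (_ * X)](sqr_sqrtr (ltW n0)) /k; field; exact: lt0r_neq0.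
  have scaleE B : ((k *: v) *m B *m (k *: v)^T) 0 0 = k * (k * (v *m B *m v^T) 0 0).
    by rewrite linearZ/= -!scalemxAl -scalemxAr !mxE.
  have kv1 : k *: v \in [set v : 'rV[R]_d | (v *m v^T) 0 0 = 1].
    by rewrite inE/= -[X in X *m _]mulmx1 scaleE mulmx1; exact: ks.
  have := umin _ kv1; rewrite scaleE => /(ler_wpM2r (ltW n0)); congr (_ <= _).
  rewrite -/s; set q := (X in _ * (_ * X) * _).
  by transitivity (q * (k * (k * s))); [ring | rewrite ks mulr1].
exists a => //; apply/eigenvalueP; exists u; last first.
  by apply/eqP => u0; move: u1; rewrite u0 mul0mx mxE => /esym/eqP; rewrite oner_eq0.
(* [M] is positive semidefinite and its form vanishes at [u]; this has to force [u *m M = 0], which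
   is the eigenvector equation. *)
pose M := A - a%:M.
have Msym : M^T = M by rewrite linearB/= Asym tr_scalar_mx.
have qM (v : 'rV_d) : (v *m M *m v^T) 0 0 = (v *m A *m v^T) 0 0 - a * (v *m v^T) 0 0.
  by rewrite mulmxBr mulmxBl mul_mx_scalar -scalemxAl !mxE.
have M0 (v : 'rV_d) : 0 <= (v *m M *m v^T) 0 0 by rewrite qM subr_ge0.
apply/eqP; rewrite -subr_eq0 -mul_mx_scalar -mulmxBr -/M; apply/negPn/negP => w0.
pose w := u *m M; have b0 := dotmx_gt0 w0; rewrite -/w in b0.
set b := (w *m w^T) 0 0 in b0; set c := (w *m M *m w^T) 0 0.
have c0 : 0 <= c by exact: M0.
have bE : (w *m M *m u^T) 0 0 = b.
  by rewrite -mulmxA -[M in M *m u^T]Msym -trmx_mul.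
have expand e : ((u + e *: w) *m M *m (u + e *: w)^T) 0 0 = e * b *+ 2 + e ^+ 2 * c.
  have -> : (u + e *: w)^T = u^T + e *: w^T by rewrite linearD/= linearZ.
  have u0 : (w *m u^T) 0 0 = 0 by rewrite qM u1 mulr1 subrr.
  rewrite mulmxDl -scalemxAl -/w mulmxDr -!scalemxAr !mulmxDl -!scalemxAl.
  transitivity ((w *m u^T) 0 0 + e * (w *m M *m u^T) 0 0 + e * (b + e * c)).
    rewrite /b /c; move: (w *m u^T) (w *m M *m u^T) (w *m w^T) (w *m M *m w^T).
    by move=> p q r s; rewrite !mxE.
  rewrite u0 bE; ring.
(* The form at [u + e *: w] is [2 e b + e^2 c], negative for small negative [e]. The choice
   [e = - b / (c + 1)] is the minimiser [- b / c] shifted so that it still makes sense when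
   [c = 0]. *)
have := M0 (u + (- b / (c + 1)) *: w); rewrite expand.
have c1 : 0 < c + 1 by lra.
have -> : - b / (c + 1) * b *+ 2 + (- b / (c + 1)) ^+ 2 * c =
    - (b / (c + 1)) ^+ 2 * (c + 2) by field; exact: lt0r_neq0.
have : 0 < (b / (c + 1)) ^+ 2 by rewrite exprn_gt0// divr_gt0.
by nra.
Qed.
Lemma eigenvalueN d (A : 'M[R]_d) a : eigenvalue (- A) (- a) = eigenvalue A a.
Proof.
apply/idP/idP => /eigenvalueP[v vA v0]; apply/eigenvalueP; exists v => //.
  by apply: oppr_inj; rewrite -mulmxN vA scaleNr.
by rewrite mulmxN vA scaleNr.
Qed.

Lemma lambda_maxN d (A : 'M[R]_d) : lambda_max (- A) = - lambda_min A.
Proof.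
rewrite /lambda_max /lambda_min /inf opprK; congr sup.
apply/seteqP; split => [a /= Aa|_ [a /= Aa <-]]; last by rewrite eigenvalueN.
by exists (- a); rewrite /= ?opprK// -eigenvalueN opprK.
Qed.

Lemma eigenvalue_ge d (A : 'M[R]_d) t b :
  (forall v : 'rV_d, t * (v *m v^T) 0 0 <= (v *m A *m v^T) 0 0) ->
  eigenvalue A b -> t <= b.
Proof.
move=> tA /eigenvalueP[v vA v0]; have := tA v.
have -> : (v *m A *m v^T) 0 0 = b * (v *m v^T) 0 0.
  by rewrite vA -scalemxAl; move: (v *m v^T) => p; rewrite mxE.
by rewrite ler_pM2r// dotmx_gt0.
Qed.

(** The eigenvalue from [rayleigh_min] bounds the quadratic form from below, so it is the least one.
    This trades an infimum over the spectrum for inequalities that are linear in [A], which can be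
    tested on chosen vectors. *)
Lemma lambda_min_geP d (A : 'M[R]_d) t : (0 < d)%N -> A \is symmetricmx ->
  t <= lambda_min A <->
  forall v : 'rV_d, t * (v *m v^T) 0 0 <= (v *m A *m v^T) 0 0.
Proof.
move=> d0 As; have [a Aa aA] := rayleigh_min d0 As; split => [tA v|tA].
  apply: le_trans (aA v); have [->|v0] := eqVneq v 0; first by rewrite mul0mx mxE !mulr0.
  rewrite ler_pM2r ?dotmx_gt0// (le_trans tA)// ge_inf//.
  by exists a => b; exact: eigenvalue_ge.
by apply: lb_le_inf; [exists a | move=> b; exact: eigenvalue_ge].
Qed.

(** * Diagonal and trace bounds *)

Lemma lambda_min_le_diag d (A : 'M[R]_d) i : A \is symmetricmx -> lambda_min A <= A i i.
Proof.
move=> As; have d0 : (0 < d)%N by case: d i {A As} => // -[].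
have /(lambda_min_geP _ d0 As)/(_ (delta_mx 0 i)) := lexx (lambda_min A).
by rewrite qform_delta -[X in X *m _]mulmx1 qform_delta mxE eqxx mulr1.
Qed.

Lemma lambda_min_le_mean d (A : 'M[R]_d) : (0 < d)%N -> A \is symmetricmx ->
  lambda_min A <= \tr A / d%:R.
Proof.
move=> d0 As; rewrite ler_pdivlMr ?ltr0n// /mxtrace mulr_natr.
rewrite -[d in _ *+ d]card_ord -sumr_const.
by apply: ler_sum => i _; exact: lambda_min_le_diag.
Qed.

(** The least eigenvalue [a] of [- A] gives the largest eigenvalue [- a] of [A], which dominates
    every diagonal entry. The sign hypothesis makes [- a] nonnegative, hence a singular value of
    [A]. *)
Lemma diag_le_opnorm d (A : 'M[R]_d) i : A \is symmetricmx -> 0 <= A i i ->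
  A i i <= opnorm A.
Proof.
move=> As Ai; have d0 : (0 < d)%N by case: d i {A As Ai} => // -[].
have At := symmetricmx_tr As.
have NAs : - A \is symmetricmx by apply: symmetricmxE; rewrite linearN/= At.
have [a Aa aA] := rayleigh_min d0 NAs.
have Aia : A i i <= - a.
  have := aA (delta_mx 0 i); rewrite qform_delta -[X in X *m _]mulmx1 qform_delta !mxE eqxx.
  by rewrite mulr1 lerNr.
apply: (le_trans Aia); apply: ub_le_sup; last first.
  split; first exact: le_trans Aia.
  have /eigenvalueP[v vA v0] : eigenvalue A (- a) by rewrite -eigenvalueN opprK.
  apply/eigenvalueP; exists v => //.
  by rewrite At mulmxA vA -scalemxAl vA scalerA expr2.
have AAs : - (A^T *m A) \is symmetricmx.
  by apply: symmetricmxE; rewrite linearN/= trmx_mul trmxK.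
have [c _ cA] := rayleigh_min d0 AAs.
(* The supremum needs a bounded set: [c] bounds the spectrum of [- (A^T *m A)] from below, so
   [s <= 1 + s^2 <= 1 - c] for every singular value [s]. *)
exists (1 - c) => s [s0 sA].
have : c <= - s ^+ 2 by apply: eigenvalue_ge cA _; rewrite eigenvalueN.
by nra.
Qed.

(* (tr M)^2 <= d \sum_i M_ii^2 <= d tr (M^2). *)
Lemma sqr_mean_trace_le d (M : 'M[R]_d) : M \is symmetricmx ->
  (\tr M / d%:R) ^+ 2 <= \tr (M *m M) / d%:R.
Proof.
move=> Ms; have [d0|d0] := posnP d.
  by move: M Ms; rewrite d0 => M _; rewrite invr0 !mulr0 expr0n.
have d1 : 0 < d%:R :> R by rewrite ltr0n.
set m := \tr M / d%:R; rewrite ler_pdivlMr//.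
have mE : \tr M = m * d%:R by rewrite /m divfK ?gt_eqF.
apply: (@le_trans _ _ (\sum_i M i i ^+ 2)); last first.
  apply: ler_sum => i _; rewrite mxE (bigD1 i)//= expr2 lerDl sumr_ge0// => j _.
  by rewrite -{2}(symmetricmx_tr Ms) mxE -expr2 sqr_ge0.
(* Cauchy-Schwarz for the diagonal, in the form that its variance around the mean [m] is
   nonnegative. *)
have : 0 <= \sum_i (M i i - m) ^+ 2 by apply: sumr_ge0 => i _; exact: sqr_ge0.
rewrite (eq_bigr (fun i => M i i ^+ 2 - (M i i * (m *+ 2) - m ^+ 2)));
  last by move=> i _; ring.
rewrite sumrB sumrB -mulr_suml sumr_const card_ord -/(\tr M) mE -mulr_natr; lra.
Qed.

Lemma loewner_le_trace d (A B : 'M[R]_d) : loewner_le A B -> \tr A <= \tr B.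
Proof.
case=> _ AB; rewrite -subr_ge0 -linearB/=; apply: sumr_ge0 => i _.
by rewrite -qform_delta.
Qed.

(** The left side is the average of the diagonal entries of the sum of squares, each of them at most
    its operator norm. Averaging instead of summing is what keeps [d] out of the final bound. *)
Lemma mean_trace_sqr_le_opnorm d n (A : 'I_n -> 'M[R]_d) : (0 < d)%N ->
  (forall k, A k \is symmetricmx) ->
  \sum_(k < n) \tr (A k *m A k) / d%:R <= opnorm (\sum_(k < n) A k *m A k).
Proof.
move=> d0 As; set B := \sum_k A k *m A k.
have Bs : B \is symmetricmx.
  apply: symmetricmxE; rewrite linear_sum; apply: eq_bigr => k _ /=.
  by rewrite trmx_mul symmetricmx_tr.
have Bi i : 0 <= B i i.
  rewrite summxE sumr_ge0// => k _; rewrite mxE sumr_ge0// => j _.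
  by rewrite -{2}(symmetricmx_tr (As k)) mxE -expr2 sqr_ge0.
rewrite -mulr_suml -linear_sum/= -/B ler_pdivrMr ?ltr0n// /mxtrace mulr_natr.
rewrite -[d in _ *+ d]card_ord -sumr_const.
by apply: ler_sum => i _; exact: diag_le_opnorm.
Qed.
End SymmetricMatrices.

(** * Measurability of the lower level events of the least eigenvalue *)

Section MeasurableLambdaMin.
Context {disp : measure_display} {T : measurableType disp} {R : realType}.

(** A negative value would persist on a ball, which contains a rational vector. This reduces a
    condition on all vectors to countably many. *)
Lemma rational_rV_dense d (f : 'rV[R]_d -> R) : continuous f ->
  (forall q : 'rV[rat]_d, 0 <= f (map_mx ratr q)) -> forall v, 0 <= f v.
Proof.
move=> cf fq v; rewrite leNgt; apply/negP => fv.
have /nbhs_ballP[e /= e0 ve] : nbhs v [set u | f u < 0] 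
    by apply: (cf v [set x | x < 0]); apply: open_nbhs_nbhs; split => //; exact: open_lt.
have qP (i : 'I_d) : {q : rat | ratr q \in `](v 0 i - e), (v 0 i + e)[}.
  by apply: cid; apply: rat_in_itvoo; lra.
pose q : 'rV[rat]_d := \row_i projT1 (qP i).
suff vq : ball v e (map_mx ratr q : 'rV[R]_d) by have := ve _ vq; rewrite /= ltNge fq.
split => // i j; rewrite ord1 !mxE /ball/=; case: (qP j) => r /=.
by rewrite in_itv/= ltr_distlC => /andP[-> ->].
Qed.

(* Needed because a measure is unconstrained on non-measurable sets. *)
Lemma measurable_lambda_min_ge d (S : T -> 'M[R]_d) t : (0 < d)%N ->
  (forall w, S w \is symmetricmx) ->
  (forall i j, measurable_fun setT (fun w => S w i j)) ->
  measurable [set w | t <= lambda_min (S w)].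
Proof.
move=> d0 Ss mS.
(* [q] enumerates all rational vectors through their codes; a number that codes nothing is sent to
   0, where the inequality is trivial. *)
pose q n : 'rV[R]_d := map_mx ratr (odflt 0 (unpickle n : option 'rV[rat]_d)).
rewrite (_ : [set w | _] = \bigcap_n
    [set w | t * (q n *m (q n)^T) 0 0 <= (q n *m S w *m (q n)^T) 0 0]); last first.
  apply/seteqP; split => w /=; rewrite lambda_min_geP//.
    by move=> tS n _ /=.
  move=> tS v; rewrite -subr_ge0; move: v; apply: rational_rV_dense.
    rewrite (_ : (fun v => _) = fun v : 'rV[R]_d => (v *m (S w - t%:M) *m v^T) 0 0).
      exact: continuous_qform.
    by apply/funext => v; rewrite mulmxBr mulmxBl mul_mx_scalar -scalemxAl !mxE.
  by move=> v; have := tS (pickle v) I; rewrite /q/= pickleK/= subr_ge0.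
apply: bigcapT_measurable => n.
rewrite -[X in measurable X]setTI.
apply: measurable_fun_le => //; apply: eq_measurable_fun.
  by move=> w _; symmetry; exact: qformE.
apply: measurable_sum => i; apply: measurable_sum => j.
by apply: measurable_funM => //; apply: measurable_funM.
Qed.
End MeasurableLambdaMin.

(** * Azuma's inequality *)

Section Azuma.
Context {disp : measure_display} {T : measurableType disp} {R : realType}.
Variable P : probability T R.
Local Open Scope ereal_scope.

(** The sum counts the positive integers up to [u]; since [u <= m] it misses none, so it is the
    integer part of [u]. *)
Lemma count_le_real (u : R) m : (0 <= u <= m%:R)%R ->
  (u - 1 <= \sum_(j < m) (j.+1%:R <= u)%R%:R <= u)%R.
Proof.
elim: m u => [|m IHm] u /andP[u0 um]; first by rewrite big_ord0; lra.
rewrite big_ord_recr/=; have [uM|uM] := leP u m%:R.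
  rewrite (_ : (m.+1%:R <= u)%R = false) ?addr0; first by apply: IHm; rewrite u0.
  by apply/negbTE; rewrite -ltNge (le_lt_trans uM)// ltr_nat.
rewrite (eq_bigr (fun=> 1%R)); last first.
  by move=> j _; rewrite (le_trans _ (ltW uM))// ler_nat.
rewrite sumr_const card_ord -natr1 in um *.
by have [uM1|uM1] := leP (m%:R + 1)%R u; rewrite /= ?mulr1n ?mulr0n; lra.
Qed.

Lemma integral_indic_mul (B : set T) (Y : T -> R) : measurable B ->
  \int[P]_w (\1_B w * Y w)%:E = \int[P]_(w in B) (Y w)%:E.
Proof.
move=> mB; rewrite [RHS]integral_mkcond; apply: eq_integral => w _.
by rewrite patchE indicE; case: ifPn; rewrite ?mul1r ?mul0r.
Qed.

(* The bounded variable c Z is approximated within 1 by the counting variable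
   h = \sum_j \1_[j + 1 <= c Z], for which the claim is an instance of Y_mean0;
   hence c |E (Z Y)| <= E |Y| for every c > 0. *)
Lemma integral_mul_mean0 (U : set (set T)) (Y : T -> R)
    (Z : g_sigma_algebraType U -> R) (M : R) :
  <<s U >> `<=` measurable ->
  P.-integrable setT (EFin \o Y) ->
  (forall B, <<s U >> B -> \int[P]_(w in B) (Y w)%:E = 0) ->
  measurable_fun setT Z -> (forall w, 0 <= Z w <= M)%R ->
  \int[P]_w (Z w * Y w)%:E = 0.
Proof.
move=> UT intY Y_mean0 mZ Z01.
have mZT : measurable_fun [set: T] (Z : T -> R).
  by move=> _ B mB; apply: UT; exact: mZ.
have intM (h : T -> R) : measurable_fun [set: T] h ->
    (exists C : R, forall w, `|h w| <= C)%R ->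
    P.-integrable setT (EFin \o (fun w => h w * Y w)%R).
  move=> mh [C hC]; apply: (@integrableMr _ _ _ P _ _ h (EFin \o Y)) => //.
  by exists C; split => [|x Cx w _ /=]; rewrite ?num_real// (le_trans (hC w))// ltW.
have intZY : P.-integrable setT (EFin \o (fun w => Z w * Y w)%R).
  apply: intM => //; exists M => w; have /andP[Z0 ZM] := Z01 w.
  by rewrite ger0_norm.
pose B (c : R) j : set T := [set w | (j.+1%:R <= c * Z w)%R].
have UB c j : <<s U >> (B c j).
  have : measurable_fun [set: g_sigma_algebraType U] (fun w => c * Z w)%R.
    by apply: measurable_funM.
  move=> /(_ measurableT `[j.+1%:R, +oo[%classic (measurable_itv _)).
  rewrite setTI; congr (<<s U >> _).
  by apply/seteqP; split => w; rewrite /B/= in_itv/= andbT.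
have mB c j : measurable (B c j) by apply: UT.
pose h c m (w : T) : R := (\sum_(j < m) \1_(B c j) w)%R.
have mh c m : measurable_fun setT (h c m).
  by apply: measurable_sum => j; exact: measurable_indic.
have hm c m w : (`|h c m w| <= m%:R)%R.
  rewrite ger0_norm ?sumr_ge0// -[m in leRHS]card_ord -sum1_card natr_sum.
  by apply: ler_sum => j _; rewrite indicE; case: (_ \in _).
have int_hY c m : P.-integrable setT (EFin \o (fun w => h c m w * Y w)%R).
  by apply: intM => //; exists m%:R.
have hY0 c m : \int[P]_w (h c m w * Y w)%:E = 0.
  elim: m => [|m IHm].
    by apply: integral0_eq => w _; rewrite /h big_ord0 mul0r.
  under eq_integral do rewrite /h big_ord_recr/= mulrDl EFinD.
  rewrite integralD//=; first by rewrite IHm add0e integral_indic_mul// Y_mean0.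
    exact: int_hY.
  apply: intM; first exact: measurable_indic.
  by exists 1%R => w; rewrite indicE; case: (_ \in _); rewrite /= ?normr1 ?normr0.
have key (c : R) : (0 < c)%R ->
    (c * `|\int[P]_w (Z w * Y w)| <= \int[P]_w `|Y w|)%R.
  (* With this many terms the count reaches every value of [c * Z w], so the error stays below 1
     uniformly in [w]. *)
  move=> c0; pose m := Num.bound (c * M).
  rewrite -{1}(gtr0_norm c0) -normrM -RintegralZl//.
  have -> : (\int[P]_x (c * (Z x * Y x)) = \int[P]_x (c * (Z x * Y x) - h c m x * Y x))%R.
    rewrite RintegralB//=.
      by rewrite [X in (_ - X)%R]/Rintegral hY0 subr0.
    exact: (integrableZl _ c intZY).
  have intD : P.-integrable setT (EFin \o (fun x => c * (Z x * Y x) - h c m x * Y x)%R).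
    have := integrableB measurableT (integrableZl measurableT c intZY) (int_hY c m).
    by apply: eq_integrable.
  apply: (le_trans (le_normr_Rintegral measurableT intD)).
  apply: le_Rintegral => //; first exact: integrable_norm.
    exact: integrable_norm.
  move=> w _; rewrite mulrA -mulrBl normrM ler_piMl//.
  have /andP[Z0 ZM] := Z01 w.
  have cZ : (0 <= c * Z w <= m%:R)%R.
    have cM : (c * Z w <= c * M)%R by rewrite ler_pM2l.
    have cZ0 : (0 <= c * Z w)%R by rewrite mulr_ge0// ltW.
    by rewrite cZ0 (le_trans cM)// ltW// archi_boundP// (le_trans cZ0).
  have /andP[h1 h2] := count_le_real cZ.
  have -> : h c m w = (\sum_(j < m) (j.+1%:R <= c * Z w)%R%:R)%R.
    apply: eq_bigr => j _; rewrite indicE; congr ((nat_of_bool _)%:R)%R.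
    by apply/idP/idP => [/set_mem|?]; last exact/mem_set.
  rewrite ger0_norm; lra.
rewrite -(fineK (integrable_fin_num measurableT intZY)); congr EFin.
apply/eqP; rewrite -normr_le0 leNgt; apply/negP => x0.
set x := `|_|%R in x0.
set C := (\int[P]_w `|Y w|)%R.
have C0 : (0 <= C)%R by apply: Rintegral_ge0.
(* Were [x] positive, [c = (C + 1) / x] would give [C + 1 <= C]. *)
have : ((C + 1) / x * x <= C)%R by apply: key; rewrite divr_gt0//; lra.
rewrite divfK ?gt_eqF//; lra.
Qed.
(* The factor 2, not optimal but affordable for the constant 8, lets
   1 + x <= expR x suffice. *)
Lemma expR_le_id_plus_expR_sqr (x : R) : (expR x <= x + expR (2 * x ^+ 2))%R.
Proof.
(* Beyond 1/2, [x <= 2 x^2] suffices. Below, [expR x <= 1 / (1 - x)], and [(1 + x + 2 x^2) (1 - x) =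
   1 + x^2 (1 - 2 x)] is at least 1. *)
have [x2|x2] := leP x (1 / 2)%R; last first.
  apply: ler_wpDl; first by lra.
  rewrite ler_expR; nra.
suff : (expR x <= 1 + x + 2 * x ^+ 2)%R.
  by have := expR_ge1Dx (2 * x ^+ 2)%R; lra.
have x1 : (0 < 1 - x)%R by lra.
rewrite -[leLHS]invrK -expRN.
apply: (@le_trans _ _ (1 - x)^-1%R).
  by rewrite lef_pV2 ?posrE ?expR_gt0// expR_ge1Dx.
rewrite -[leLHS]mul1r ler_pdivrMr//; nra.
Qed.

(** Provides the almost sure cap on partial sums at which [mgf_le] truncates. *)
Lemma ae_le_sum n (Y : 'I_n -> T -> R) (a : 'I_n -> R) :
  (forall k, {ae P, forall w, `|Y k w| <= a k}%R) ->
  {ae P, forall w, \sum_k Y k w <= \sum_k a k}%R.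
Proof.
move=> Ya; have : {ae P, forall w, forall k, `|Y k w| <= a k}%R by exact: filter_forall.
apply: filterS => w Yw.
by apply: ler_sum => k _; exact: le_trans (ler_norm _) (Yw k).
Qed.

(** Induction on [n], splitting off the last increment [y]. Its exponential is at most [l * y + K],
    and the linear term integrates to 0 against any bounded weight determined by the past, which
    leaves the factor [K]. *)
Lemma mgf_le (l : R) n (U : 'I_n -> set (set T)) (Y : 'I_n -> T -> R) (a : 'I_n -> R) :
  (0 <= l)%R ->
  (forall k, <<s U k >> `<=` measurable) ->
  (forall j k : 'I_n, (j < k)%N ->
    measurable_fun [set: g_sigma_algebraType (U k)] (Y j)) ->
  (forall k, P.-integrable setT (EFin \o Y k)) ->
  (forall k B, <<s U k >> B -> \int[P]_(w in B) (Y k w)%:E = 0) ->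
  (forall k, {ae P, forall w, `|Y k w| <= a k}%R) ->
  \int[P]_w (expR (l * \sum_k Y k w))%:E <= (expR (2 * l ^+ 2 * \sum_k a k ^+ 2))%:E.
Proof.
move=> l0; elim: n U Y a => [|n IHn] U Y a Um Ym Yint Y0 Ya.
  under eq_integral do rewrite big_ord0 mulr0 expR0.
  by rewrite integral_cst// [X in _ * X]probability_setT mul1e big_ord0 mulr0 expR0.
pose i (k : 'I_n) := widen_ord (leqnSn n) k.
have {}IHn := IHn (U \o i) (Y \o i) (a \o i)
  (fun k => Um (i k)) (fun j k => Ym (i j) (i k))
  (fun k => Yint (i k)) (fun k => Y0 (i k)) (fun k => Ya (i k)).
pose S w : R := (\sum_(k < n) Y (i k) w)%R.
pose y := Y ord_max; pose V := U ord_max; pose b := a ord_max.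
have yint : P.-integrable setT (EFin \o y) by exact: Yint.
have my : measurable_fun setT y by apply/measurable_EFinP; exact: measurable_int yint.
have SV : measurable_fun [set: g_sigma_algebraType V] S.
  by apply: measurable_sum => k; apply: Ym; exact: (ltn_ord k).
have mS : measurable_fun setT S.
  by apply: measurable_sum => k; apply/measurable_EFinP; exact: measurable_int (Yint _).
have mexp : measurable_fun setT (fun w => expR (l * S w)).
  by apply: measurableT_comp => //; exact: measurable_funM.
(* [integral_mul_mean0] wants a weight bounded everywhere, but [S] is bounded only almost surely.
   Truncating at [M] alters the weight on a null set only. *)
pose M := expR (l * \sum_(k < n) a (i k))%R.
pose Z w := Num.min (expR (l * S w)) M.
have ZV : measurable_fun [set: g_sigma_algebraType V] Z.
  apply: measurable_minr => //; apply: measurableT_comp => //.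
  exact: measurable_funM.
have mZ : measurable_fun [set: T] Z by apply: measurable_minr.
have Z0 w : (0 <= Z w)%R by rewrite le_min !expR_ge0.
have ZM w : (Z w <= M)%R by rewrite ge_min lexx orbT.
have Zae : {ae P, forall w, Z w = expR (l * S w)}.
  have := ae_le_sum (fun k => Ya (i k)); apply: filterS => w Sw.
  by apply: min_l; rewrite ler_expR ler_wpM2l.
pose K := expR (2 * l ^+ 2 * b ^+ 2).
have Zy0 : \int[P]_w (Z w * y w)%:E = 0.
  by apply: (@integral_mul_mean0 V y Z M) => //;
    [exact: Um | exact: Y0 | move=> w; rewrite Z0 ZM].
have bddZ : [bounded Z w | w in [set: T]].
  by exists M; split => [|x Mx w _ /=]; rewrite ?num_real// ger0_norm// (le_trans (ZM w))// ltW.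
have Zyint : P.-integrable setT (EFin \o (fun w => Z w * y w)%R).
  exact: (@integrableMr _ _ _ P _ _ Z (EFin \o y)).
have Zint : P.-integrable setT (EFin \o Z).
  by apply: measurable_bounded_integrable => //; rewrite [X in X < _]probability_setT ltry.
have yae : {ae P, forall w, expR (l * y w) <= l * y w + K}%R.
  apply: filterS (Ya ord_max) => w yw; apply: (le_trans (expR_le_id_plus_expR_sqr _)).
  rewrite lerD2l ler_expR exprMn -mulrA !ler_wpM2l ?sqr_ge0//.
  by rewrite -[(y w ^+ 2)%R]real_normK ?num_real// ler_pXn2r ?nnegrE// (le_trans _ yw).
have mrhs : measurable_fun setT (fun w => Z w * (l * y w + K))%R.
  by apply: measurable_funM => //; apply: measurable_funD => //; apply: measurable_funM.
(* The absolute value makes the integrand nonnegative everywhere: [l * y w + K] may be negative on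
   the null set where the bound on [y] fails. *)
apply: (@le_trans _ _ (\int[P]_w `|Z w * (l * y w + K)|%R%:E)).
  apply: ae_ge0_le_integral => //.
  - apply/measurable_EFinP; apply: measurableT_comp => //; apply: measurable_funM => //.
    by apply: measurable_sum => k; apply/measurable_EFinP; exact: measurable_int (Yint _).
  - by apply/measurable_EFinP; exact: measurableT_comp.
  move: yae Zae; apply: filterS2 => w yw Zw _.
  rewrite lee_fin Zw big_ord_recr/= -/(S w) -/(y w) mulrDr expRD.
  by apply: le_trans (ler_norm _); rewrite ler_wpM2l ?expR_ge0.
have -> : \int[P]_w `|Z w * (l * y w + K)|%R%:E = \int[P]_w (Z w * (l * y w + K))%:E.
  apply: ae_eq_integral => //.
  - by apply/measurable_EFinP; exact: measurableT_comp.
  - exact/measurable_EFinP.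
  move: yae; apply: filterS => w yw _; congr EFin; apply: ger0_norm.
  by rewrite mulr_ge0// (le_trans _ yw)// expR_ge0.
have -> : \int[P]_w (Z w * (l * y w + K))%:E = K%:E * \int[P]_w (Z w)%:E.
  transitivity (\int[P]_w (l%:E * (Z w * y w)%:E + K%:E * (Z w)%:E)).
    by apply: eq_integral => w _; rewrite -!EFinM -EFinD; congr EFin; ring.
  rewrite integralD//=; [|exact: integrableZl..].
  by rewrite !integralZl// Zy0 mule0 add0e.
rewrite big_ord_recr/= mulrDr expRD mulrC EFinM -/b -/K.
apply: lee_wpmul2l; first by rewrite lee_fin expR_ge0.
apply: le_trans IHn; apply: ge0_le_integral => //.
- by move=> w _; rewrite lee_fin.
- exact/measurable_EFinP.
- exact/measurable_EFinP.
- by move=> w _; rewrite lee_fin ge_min lexx.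
Qed.

(** Markov's inequality for the exponential of the sum. The parameter [l] stays free because the
    best choice differs when the variance bound is 0. *)
Lemma chernoff (l : R) n (U : 'I_n -> set (set T)) (Y : 'I_n -> T -> R) (a : 'I_n -> R)
    t :
  (0 <= l)%R ->
  (forall k, <<s U k >> `<=` measurable) ->
  (forall j k : 'I_n, (j < k)%N ->
    measurable_fun [set: g_sigma_algebraType (U k)] (Y j)) ->
  (forall k, P.-integrable setT (EFin \o Y k)) ->
  (forall k B, <<s U k >> B -> \int[P]_(w in B) (Y k w)%:E = 0) ->
  (forall k, {ae P, forall w, `|Y k w| <= a k}%R) ->
  P [set w | t <= \sum_k Y k w]%R <= (expR (2 * l ^+ 2 * (\sum_k a k ^+ 2) - l * t))%:E.
Proof.
move=> l0 Um Ym Yint Y0 Ya.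
have mS : measurable_fun setT (fun w => \sum_k Y k w)%R.
  by apply: measurable_sum => k; apply/measurable_EFinP; exact: measurable_int (Yint _).
have mE : measurable [set w | t <= \sum_k Y k w]%R.
  by rewrite -[X in measurable X]setTI; apply: measurable_fun_le.
set E := [set w | _] in mE *.
have mexp : measurable_fun setT (fun w => (expR (l * \sum_k Y k w))%:E).
  apply/measurable_EFinP; apply: measurableT_comp => //; exact: measurable_funM.
have markov : (expR (l * t))%:E * P E <= (expR (2 * l ^+ 2 * \sum_k a k ^+ 2))%:E.
  apply: le_trans (mgf_le l0 Um Ym Yint Y0 Ya).
  rewrite -integral_cst//.
  apply: (@le_trans _ _ (\int[P]_(w in E) (expR (l * \sum_k Y k w))%:E)).
    apply: ge0_le_integral => //.
    - by move=> w _; rewrite lee_fin expR_ge0.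
    - exact: measurable_funTS.
    - by move=> w Ew; rewrite lee_fin ler_expR ler_wpM2l.
  by apply: ge0_subset_integral => //; move=> w _; rewrite lee_fin expR_ge0.
move: markov; rewrite -(fineK (fin_num_measure P _ mE)) -EFinM !lee_fin.
by rewrite expRD expRN ler_pdivlMr ?expR_gt0// mulrC.
Qed.
End Azuma.

(** * The matrix inequality *)

Section LambdaMinTail.
Context {disp : measure_display} {T : measurableType disp} {R : realType}.
Variable P : probability T R.

(* l = t / (4 s) is optimal when 0 < s; when s = 0, let l tend to infinity. *)
Lemma le_expeR_of_chernoff (p s t : R) : 0 <= s -> 0 <= t ->
  (forall l, 0 <= l -> p <= expR (2 * l ^+ 2 * s - l * t)) ->
  (p%:E <= expeR (- (t ^+ 2)%:E / (8 * s)%:E))%E.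
Proof.
rewrite le_eqVlt => /orP[/eqP<-|s0] t0 pl; last first.
  rewrite inver gt_eqF ?mulr_gt0// -EFinN -EFinM lee_fin.
  apply: (le_trans (pl (t / (4 * s)) _)); first by rewrite divr_ge0// mulr_ge0// ltW.
  by rewrite ler_expR le_eqVlt; apply/orP; left; apply/eqP; field; exact: lt0r_neq0.
rewrite mulr0 inver eqxx.
move: t0; rewrite le_eqVlt => /orP[/eqP t0|t0].
  have := pl 0 (lexx _); rewrite -t0 expr0n !(mulr0, mul0r) subr0 expR0.
  by rewrite oppe0 mul0e expeR0 lee_fin.
rewrite -EFinN lt0_muley ?lte_fin ?oppr_lt0 ?exprn_gt0//= lee_fin leNgt; apply/negP => p0.
(* Taking [l * t = 1 / p] gives [p <= expR (- 1 / p) <= 1 / (1 + 1 / p)], that is [p + 1 <= 1],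
   which is absurd for [p > 0]. *)
have : p <= expR (- (p^-1 / t * t)).
  by have := pl (p^-1 / t); rewrite mulr0 sub0r => -> //; rewrite divr_ge0 ?invr_ge0 ?ltW.
rewrite divfK ?gt_eqF// expRN => h.
have : p <= (1 + p^-1)^-1.
  apply: (le_trans h); rewrite lef_pV2 ?posrE ?expR_gt0 ?expR_ge1Dx//.
  by rewrite addr_gt0// invr_gt0.
rewrite -[leRHS]mul1r ler_pdivlMr; last by rewrite addr_gt0// invr_gt0.
rewrite mulrDr mulr1 mulfV ?gt_eqF//; lra.
Qed.

(** The past enters through arbitrary generators [U k] rather than [past X k], so that the same
    family serves both [X] and [- X]. *)
Lemma lambda_min_tail (d n : nat) (U : 'I_n -> set (set T))
    (X : 'I_n -> T -> 'M[R]_d) (A : 'I_n -> 'M[R]_d) (t : R) :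
  (0 < d)%N ->
  (forall k, <<s U k >> `<=` measurable) ->
  (forall j k : 'I_n, (j < k)%N -> forall i i',
    measurable_fun [set: g_sigma_algebraType (U k)] (fun w => X j w i i')) ->
  (forall k i i', P.-integrable setT (EFin \o (fun w => X k w i i'))) ->
  (forall k i i' B, <<s U k >> B -> (\int[P]_(w in B) (X k w i i')%:E = 0)%E) ->
  (forall k w, X k w \is symmetricmx) ->
  (forall k, A k \is symmetricmx) ->
  (forall k, {ae P, forall w, loewner_le (X k w *m X k w) (A k *m A k)}) ->
  0 <= t ->
  (P [set w | (t <= lambda_min (\sum_(k < n) X k w))%R] <=
     expeR (- (t ^+ 2)%:E / (8 * opnorm (\sum_(k < n) A k *m A k))%:E))%E.
Proof.
move=> d0 Um Xm Xint X0 Xs As XA t0.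
have Ss w : \sum_(k < n) X k w \is symmetricmx.
  by apply: symmetricmxE; rewrite linear_sum; apply: eq_bigr => k _ /=; rewrite symmetricmx_tr.
have mX k i i' : measurable_fun setT (fun w => X k w i i').
  by apply/measurable_EFinP; exact: measurable_int (Xint _ _ _).
have mE : measurable [set w | t <= lambda_min (\sum_(k < n) X k w)].
  apply: measurable_lambda_min_ge => // i j.
  by under eq_fun do rewrite summxE; exact: measurable_sum.
pose Y k w := \tr (X k w) / d%:R.
(* The scalar bound on [Y k]; the radicand is nonnegative because it dominates the square of the
   mean trace of [A k]. *)
pose a k := Num.sqrt (\tr (A k *m A k) / d%:R).
have a2 k : a k ^+ 2 = \tr (A k *m A k) / d%:R.
  by rewrite sqr_sqrtr// (le_trans _ (sqr_mean_trace_le (As k)))// sqr_ge0.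
have YE k : EFin \o Y k = fun w => (\sum_i (d%:R^-1)%:E * (X k w i i)%:E)%E.
  apply/funext => w /=; rewrite /Y /mxtrace mulr_suml -sumEFin.
  by apply: eq_bigr => i _; rewrite -EFinM mulrC.
have Xint' k i : P.-integrable setT (fun w => (d%:R^-1)%:E * (X k w i i)%:E)%E.
  exact: (integrableZl measurableT d%:R^-1 (Xint k i i)).
have Yint k : P.-integrable setT (EFin \o Y k) by rewrite YE; exact: integrable_sum.
have Ym (j k : 'I_n) : (j < k)%N -> measurable_fun [set: g_sigma_algebraType (U k)] (Y j).
  by move=> jk; apply: measurable_funM => //; apply: measurable_sum => i; apply: Xm.
have Y0 k B : <<s U k >> B -> (\int[P]_(w in B) (Y k w)%:E = 0)%E.
  move=> UB; have mB : measurable B := Um _ _ UB.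
  have intB i : P.-integrable B (fun w => (X k w i i)%:E).
    exact: (integrableS measurableT mB (@subsetT _ B) (Xint k i i)).
  have -> : (fun w => (Y k w)%:E) = (fun w => (\sum_i (d%:R^-1)%:E * (X k w i i)%:E)%E).
    exact: YE.
  rewrite integral_sum//; last by move=> i; exact: integrableZl.
  by apply: big1 => i _; rewrite integralZl// X0// mule0.
have Ya k : {ae P, forall w, `|Y k w| <= a k}.
  apply: filterS (XA k) => w /loewner_le_trace trXA.
  rewrite -sqrtr_sqr ler_sqrt ?(le_trans (sqr_mean_trace_le (Xs k w)))//.
    by rewrite ler_wpM2r// invr_ge0.
  by rewrite -a2 sqr_ge0.
have s0 : \sum_k a k ^+ 2 <= opnorm (\sum_(k < n) A k *m A k).
  by under eq_bigr do rewrite a2; exact: mean_trace_sqr_le_opnorm.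
rewrite -(fineK (fin_num_measure P _ mE)); apply: le_expeR_of_chernoff => //.
  by apply: le_trans s0; apply: sumr_ge0 => k _; exact: sqr_ge0.
move=> l l0; rewrite -lee_fin fineK ?fin_num_measure//.
apply: (@le_trans _ _ (P [set w | t <= \sum_k Y k w])).
  apply: le_measure; rewrite ?inE//.
    rewrite -[X in measurable X]setTI; apply: measurable_fun_le => //.
    by apply: measurable_sum => k; apply/measurable_EFinP; exact: measurable_int (Yint k).
  move=> w /= tw; apply: (le_trans tw); apply: (le_trans (lambda_min_le_mean d0 (Ss w))).
  by rewrite linear_sum mulr_suml.
apply: le_trans (chernoff t l0 Um Ym Yint Y0 Ya) _.
by rewrite lee_fin ler_expR lerD2r ler_wpM2l// mulr_ge0// sqr_ge0.
Qed.
End LambdaMinTail.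

(* In \bar R, x / 0 = x * +oo and 0 * +oo = 0, so when sigma2 = 0 the bound
   is e^(-oo) = 0 for t > 0 and 1 for t = 0. *)
Theorem theorem2p14 (R : realType) (disp : measure_display)
    (T : measurableType disp) (P : probability T R) (d n : nat)
    (F : 'I_n -> set (set T)) (X : 'I_n -> T -> 'M[R]_d) (A : 'I_n -> 'M[R]_d)
    (d_gt0 : (0 < d)%N)
    (F_filtration : filtration F)
    (X_adapted : adapted F X)
    (X_sym : forall k w, X k w \is symmetricmx)
    (A_sym : forall k, A k \is symmetricmx)
    (X_centered : forall k,
      is_mx_cond_expectation P (past X k) (X k) (fun _ => 0))
    (X_le_A : forall k,
      {ae P, forall w, loewner_le (X k w *m X k w) (A k *m A k)}) :
  let sigma2 := opnorm (\sum_(k < n) A k *m A k) in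
  forall t : R, 0 <= t ->
    (P [set w | (t <= lambda_min (\sum_(k < n) X k w))%R]
       <= expeR (- (t ^+ 2)%R%:E / (8 * sigma2)%R%:E))%E /\
    (P [set w | (lambda_max (\sum_(k < n) X k w) <= - t)%R]
       <= expeR (- (t ^+ 2)%R%:E / (8 * sigma2)%R%:E))%E.
Proof.
move=> sigma2 t t0.
(* [<<s U k >>] is [past X k] by definition, so centering given the past yields zero integrals over
   its events. *)
pose U (k : 'I_n) := \bigcup_(j in [set j : 'I_n | (j < k)%N]) mx_preimages (X j).
have Xint k i i' : P.-integrable setT (EFin \o (fun w => X k w i i')).
  by case: (X_centered k i i').
have mX k i i' : measurable_fun setT (fun w => X k w i i').
  by apply/measurable_EFinP; exact: measurable_int (Xint k i i').
have Um k : <<s U k >> `<=` measurable.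
  apply: smallest_sub; first exact: sigma_algebra_measurable.
  by move=> _ [j _ [i [i' [B mB <-]]]]; exact: mX.
have Xm (j k : 'I_n) : (j < k)%N -> forall i i',
    measurable_fun [set: g_sigma_algebraType (U k)] (fun w => X j w i i').
  move=> jk i i' _ B mB; apply: sub_sigma_algebra.
  by exists j => //; exists i, i', B.
have X0 k i i' B : <<s U k >> B -> (\int[P]_(w in B) (X k w i i')%:E = 0)%E.
  case: (X_centered k i i') => _ _ _ /(_ B) + UB => ->//.
  by apply: integral0_eq => w _; rewrite mxE.
split; first exact: (lambda_min_tail d_gt0 Um).
rewrite (_ : [set w | _] = [set w | t <= lambda_min (\sum_(k < n) - X k w)]); last first.
  by apply/seteqP; split => w /=; rewrite sumrN -[X in lambda_max X]opprK lambda_maxN lerN2.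
apply: (lambda_min_tail d_gt0 Um) => //.
- move=> j k jk i i'; under eq_fun do rewrite mxE.
  exact: measurableT_comp (Xm _ _ jk i i').
- move=> k i i'; rewrite (_ : EFin \o _ = -%E \o (EFin \o (fun w => X k w i i'))).
    exact: integrableN.
  by apply/funext => w /=; rewrite mxE.
- move=> k i i' B UB; under eq_integral do rewrite mxE EFinN.
  have mB := Um k _ UB; rewrite integralN ?X0 ?oppe0//.
  exact: integrable_add_def (integrableS measurableT mB (@subsetT _ B) (Xint k i i')).
- by move=> k w; apply: symmetricmxE; rewrite linearN/= symmetricmx_tr.
- by move=> k; apply: filterS (X_le_A k) => w; rewrite mulmxN mulNmx opprK.
Qed.
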